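(* For every real $\alpha$ with $|\alpha|\le 1$, $$2\int_0^1\frac{\arctan(\alpha x)}{1+x^2}\,dx=\sum_{n=0}^\infty\left(\log 2-H_n^-\right)\frac{\alpha^{2n+1}}{2n+1}.$$ In particular, for $\alpha=1$, $$\frac{\pi^2}{16}=\sum_{n=0}^\infty\left(\log 2-H_n^-\right)\frac{1}{2n+1}.$$
   Context: The skew-harmonic numbers are $H_0^-=0$ and $H_n^-=\sum_{k=1}^n\frac{(-1)^{k-1}}{k}=1-\frac12+\frac13-\cdots+\frac{(-1)^{n-1}}{n}$ for $n\ge 1$. *)

(* Defs.v *)
From Stdlib Require Import Reals.
From Coquelicot Require Import Coquelicot.

Open Scope R_scope.

(* The sum over k = 1, ..., n; for n = 0 the range is empty and
   [sum_n_m _ 1 0] is 0. *)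
Definition skew_harmonic (n : nat) : R :=
  sum_n_m (fun k : nat => (-1) ^ (k - 1) / INR k) 1 n.

(* Main.v *)
(** By induction on [n], [ln 2 - H_n^-] is [(-1)^n] times the integral of
    [2 x^(2n+1) / (1 + x^2)] over [0, 1]. Hence the partial sums of the series
    are the integrals of [2 P_N (alpha x) / (1 + x^2)], where [P_N] is the
    Taylor polynomial of the arctangent, and [P_N] tends to [atan] uniformly
    on [-1, 1]. For [alpha = 1] the integrand has the primitive [(atan x)^2]. *)

Require Import Defs.
From Stdlib Require Import Reals Lra Lia.
From Coquelicot Require Import Coquelicot.

Open Scope R_scope.

(** * Taylor polynomials of the arctangent and their remainder *)

Definition atan_coef (n : nat) : R := (-1) ^ n / INR (2 * n + 1).

Definition atan_poly (N : nat) (y : R) : R :=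
  sum_n (fun n => atan_coef n * y ^ (2 * n + 1)) N.

(** Turns the operations of Coquelicot's algebraic structures into those of [R]; the final [change]
    retypes the equality over [R], so that [ring] and [field] apply. *)
Ltac to_real_ops :=
  unfold minus, plus, opp, scal;
  cbn -[pow INR Nat.mul Nat.add sum_n atan_poly skew_harmonic];
  unfold mult; cbn -[pow INR Nat.mul Nat.add sum_n atan_poly skew_harmonic];
  match goal with
  | |- @eq _ ?a ?b => change (@eq R a b)
  | _ => idtac
  end.

Lemma one_plus_sqr_pos (x : R) : 0 < 1 + x ^ 2.
Proof. generalize (pow2_ge_0 x); lra. Qed.

Lemma INR_odd_pos (n : nat) : 0 < INR (2 * n + 1).
Proof. apply lt_0_INR; lia. Qed.

Lemma pow_even_ge_0 (x : R) (n : nat) : 0 <= x ^ (2 * n).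
Proof. rewrite pow_mult; apply pow_le, pow2_ge_0. Qed.

Lemma sqr_pow_opp1 (n : nat) : (-1) ^ n * (-1) ^ n = 1.
Proof. rewrite <- Rpow_mult_distr; replace (-1 * -1) with 1 by ring; apply pow1. Qed.

(** The factor [c] serves both the terms of [atan_poly], with [c = (-1) ^ n], and the monomial
    bounding the error, with [c = 1]. *)
Lemma is_derive_odd_monomial (c y : R) (n : nat) :
  is_derive (fun y => c / INR (2 * n + 1) * y ^ (2 * n + 1)) y (c * y ^ (2 * n)).
Proof.
  auto_derive; [easy |].
  replace (Init.Nat.pred _) with (2 * n)%nat by lia.
  change (n + (n + 0))%nat with (2 * n)%nat.
  field; apply Rgt_not_eq, INR_odd_pos.
Qed.

(** The derivative is the geometric sum of [(- y ^ 2) ^ n] for [n <= N], written in closed form. *)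
Lemma is_derive_atan_poly (N : nat) (y : R) :
  is_derive (atan_poly N) y ((1 - (-1) ^ S N * y ^ (2 * S N)) / (1 + y ^ 2)).
Proof.
  assert (Hp := one_plus_sqr_pos y).
  induction N as [| N IH].
  - apply (is_derive_ext (fun y => 1 / INR (2 * 0 + 1) * y ^ (2 * 0 + 1))).
    { intros t; unfold atan_poly; rewrite sum_O; reflexivity. }
    evar_last; [apply is_derive_odd_monomial |]. simpl in *; field; lra.
  - apply (is_derive_ext
      (fun y => plus (atan_poly N y) (atan_coef (S N) * y ^ (2 * S N + 1)))).
    { intros t; unfold atan_poly; rewrite sum_Sn; reflexivity. }
    evar_last.
    { apply @is_derive_plus; [exact IH | apply is_derive_odd_monomial]. }
    to_real_ops.
    replace (2 * S (S N))%nat with (2 * S N + 2)%nat by lia.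
    rewrite pow_add, <- (tech_pow_Rmult (-1) (S N)).
    field; lra.
Qed.

(** The closed form of the geometric sum contains [1 / (1 + y ^ 2)], which cancels against the
    derivative of [atan] and leaves only the tail. *)
Lemma is_derive_atan_remainder (N : nat) (y : R) :
  is_derive (fun y => atan y - atan_poly N y) y
    ((-1) ^ S N * y ^ (2 * S N) / (1 + y ^ 2)).
Proof.
  assert (Hp := one_plus_sqr_pos y).
  evar_last.
  { apply @is_derive_minus;
      [apply is_derive_Reals, derivable_pt_lim_atan | apply is_derive_atan_poly]. }
  to_real_ops.
  unfold Rsqr; simpl in Hp; field; repeat split; nra.
Qed.

Lemma nondecreasing_of_derive_ge_0 (f df : R -> R) :
  (forall x, is_derive f x (df x)) -> (forall x, 0 <= df x) ->
  forall x y, x <= y -> f x <= f y.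
Proof.
  intros Hf Hdf x y Hxy.
  destruct (MVT_gen f x y df) as [c [_ Hc]].
  - intros; apply Hf.
  - intros; apply continuity_pt_filterlim, (@ex_derive_continuous _ R_NormedModule).
    eexists; apply Hf.
  - generalize (Rmult_le_pos _ (y - x) (Hdf c)); lra.
Qed.

Lemma atan_poly_0 (N : nat) : atan_poly N 0 = 0.
Proof.
  induction N as [| N IH]; unfold atan_poly in *.
  - rewrite sum_O; simpl; ring.
  - rewrite sum_Sn, IH, pow_i by lia; to_real_ops; ring.
Qed.

Lemma atan_poly_error (N : nat) (y : R) :
  Rabs (atan y - atan_poly N y) <= Rabs (y ^ (2 * S N + 1) / INR (2 * S N + 1)).
Proof.
  (* The monomial plus or minus the remainder is nondecreasing and vanishes at 0. *)
  assert (key : forall s, s = 1 \/ s = -1 -> forall x y, x <= y ->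
    1 / INR (2 * S N + 1) * x ^ (2 * S N + 1) + s * (atan x - atan_poly N x) <=
    1 / INR (2 * S N + 1) * y ^ (2 * S N + 1) + s * (atan y - atan_poly N y)).
  { intros s Hs.
    apply (nondecreasing_of_derive_ge_0 _ (fun z =>
      1 * z ^ (2 * S N) + s * ((-1) ^ S N * z ^ (2 * S N) / (1 + z ^ 2)))).
    - intros x. apply @is_derive_plus; [apply is_derive_odd_monomial |].
      apply (is_derive_scal (fun y => atan y - atan_poly N y)).
      apply is_derive_atan_remainder.
    - intros z.
      assert (H0 := pow_even_ge_0 z (S N)).
      assert (Hp := one_plus_sqr_pos z).
      assert (Hz := pow2_ge_0 z).
      assert (Hm : (-1) ^ S N = 1 \/ (-1) ^ S N = -1).
      { generalize (S N); intros m; induction m as [| m IH]; simpl; lra. }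
      (* As [1 + z ^ 2 >= 1], the derivative of the remainder is at most that of the monomial in
         absolute value, so their sum is nonnegative for either sign. *)
      assert (Hle : 0 <= z ^ (2 * S N) / (1 + z ^ 2) <= z ^ (2 * S N)).
      { split; [apply Rdiv_le_0_compat; lra |].
        apply Rle_div_l; [lra | nra]. }
      unfold Rdiv in *; rewrite Rmult_assoc.
      destruct Hs as [-> | ->], Hm as [-> | ->]; lra. }
  assert (H1 := key 1 (or_introl eq_refl)).
  assert (H2 := key (-1) (or_intror eq_refl)).
  assert (Hz : 1 / INR (2 * S N + 1) * 0 ^ (2 * S N + 1) = 0)
    by (rewrite pow_i by lia; ring).
  assert (Ha := atan_0). assert (Hq := atan_poly_0 N).
  replace (y ^ (2 * S N + 1) / INR (2 * S N + 1))
    with (1 / INR (2 * S N + 1) * y ^ (2 * S N + 1))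
    by (field; apply Rgt_not_eq, INR_odd_pos).
  (* The exponent is odd, so the monomial has the sign of [y], and 0 is the left or the right end of
     the interval accordingly. *)
  destruct (Rle_dec 0 y) as [Hy | Hy].
  - specialize (H1 0 y Hy); specialize (H2 0 y Hy).
    rewrite Hz, Ha, Hq in *.
    rewrite (Rabs_pos_eq (1 / _ * _)) by lra. apply Rabs_le; lra.
  - assert (Hy' : y <= 0) by lra.
    specialize (H1 y 0 Hy'); specialize (H2 y 0 Hy').
    rewrite Hz, Ha, Hq in *.
    rewrite (Rabs_left1 (1 / _ * _)) by lra. apply Rabs_le; lra.
Qed.

(** * Skew-harmonic numbers as integrals *)

Lemma skew_harmonic_S (n : nat) :
  skew_harmonic (S n) = skew_harmonic n + (-1) ^ n / INR (S n).
Proof.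
  unfold skew_harmonic; rewrite sum_n_Sm by lia.
  replace (S n - 1)%nat with n by lia; reflexivity.
Qed.

(** Two consecutive integrals add up to the integral of [x ^ (2 * n + 1)], that is
    [1 / (2 * (n + 1))], which is half the size of the increment of [skew_harmonic]. The base case
    is [ln 2 / 2]. *)
Lemma ln2_sub_skew_harmonic_is_RInt (n : nat) :
  is_RInt (fun x => x ^ (2 * n + 1) / (1 + x ^ 2)) 0 1
    ((-1) ^ n * (ln 2 - skew_harmonic n) / 2).
Proof.
  induction n as [| n IH].
  - assert (H : is_RInt (fun x => x ^ (2 * 0 + 1) / (1 + x ^ 2)) 0 1
        (minus (ln (1 + 1 ^ 2) / 2) (ln (1 + 0 ^ 2) / 2))).
    { apply (is_RInt_derive (fun x => ln (1 + x ^ 2) / 2)).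
      - intros x _; assert (Hp := one_plus_sqr_pos x).
        auto_derive; [simpl in Hp; lra | simpl in *; field; lra].
      - intros x _; assert (Hp := one_plus_sqr_pos x).
        apply (@ex_derive_continuous _ R_NormedModule).
        auto_derive; simpl in Hp; lra. }
    evar_last; [exact H |].
    unfold skew_harmonic; rewrite sum_n_m_zero by lia.
    unfold zero; to_real_ops.
    replace (1 + 1 ^ 2) with 2 by ring.
    replace (1 + 0 ^ 2) with 1 by ring.
    rewrite ln_1; field.
  - (* [x^(2n+3) = x^(2n+1) (1 + x^2) - x^(2n+1)] *)
    assert (Hpow : is_RInt (fun x => x ^ (2 * n + 1)) 0 1 (/ (2 * INR (S n)))).
    { assert (H := is_RInt_pow 0 1 (2 * n + 1)).
      evar_last; [exact H |].
      replace (S (2 * n + 1)) with (2 * S n)%nat by lia.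
      rewrite pow1, pow_i by lia.
      rewrite mult_INR; simpl (INR 2).
      field; apply not_0_INR; lia. }
    apply (is_RInt_ext (fun x =>
      minus (x ^ (2 * n + 1)) (x ^ (2 * n + 1) / (1 + x ^ 2)))).
    { intros x _; assert (Hp := one_plus_sqr_pos x).
      replace (2 * S n + 1)%nat with (2 * n + 1 + 2)%nat by lia.
      rewrite (pow_add x (2 * n + 1) 2).
      to_real_ops; field; lra. }
    evar_last; [apply @is_RInt_minus; [exact Hpow | exact IH] |].
    rewrite skew_harmonic_S, <- tech_pow_Rmult.
    to_real_ops.
    (* The two sides differ by a multiple of [1 - (-1) ^ n * (-1) ^ n], whose vanishing [field]
       cannot see. *)
    apply Rminus_diag_uniq.
    transitivity ((1 - (-1) ^ n * (-1) ^ n) / (2 * INR (S n)));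
      [field; apply not_0_INR; lia | rewrite sqr_pow_opp1; unfold Rdiv; ring].
Qed.

(** Termwise, the sign in [atan_coef n] cancels the sign [(-1) ^ n] of the integral formula. *)
Lemma atan_poly_is_RInt (alpha : R) (N : nat) :
  is_RInt (fun x => atan_poly N (alpha * x) / (1 + x ^ 2)) 0 1
    (sum_n (fun n => (ln 2 - skew_harmonic n) *
                     (alpha ^ (2 * n + 1) / INR (2 * n + 1))) N / 2).
Proof.
  assert (term : forall n,
    is_RInt (fun x => atan_coef n * (alpha * x) ^ (2 * n + 1) / (1 + x ^ 2)) 0 1
      ((ln 2 - skew_harmonic n) * (alpha ^ (2 * n + 1) / INR (2 * n + 1)) / 2)).
  { intros n.
    apply (is_RInt_ext (fun x => scal (atan_coef n * alpha ^ (2 * n + 1))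
                                      (x ^ (2 * n + 1) / (1 + x ^ 2)))).
    { intros x _; rewrite Rpow_mult_distr.
      to_real_ops; unfold Rdiv; ring. }
    evar_last; [apply @is_RInt_scal, ln2_sub_skew_harmonic_is_RInt |].
    to_real_ops.
    unfold atan_coef, Rdiv.
    transitivity ((-1) ^ n * (-1) ^ n * ((ln 2 - skew_harmonic n) *
      (alpha ^ (2 * n + 1) * / INR (2 * n + 1)) * / 2)); [ring |].
    rewrite sqr_pow_opp1; ring. }
  induction N as [| N IH].
  - unfold atan_poly; rewrite sum_O.
    eapply is_RInt_ext; [| apply (term O)].
    intros x _; cbv beta; rewrite sum_O; reflexivity.
  - rewrite sum_Sn.
    apply (is_RInt_ext (fun x => plus (atan_poly N (alpha * x) / (1 + x ^ 2))
      (atan_coef (S N) * (alpha * x) ^ (2 * S N + 1) / (1 + x ^ 2)))).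
    { intros x _; unfold atan_poly; rewrite sum_Sn.
      to_real_ops; unfold Rdiv; ring. }
    evar_last; [apply @is_RInt_plus; [exact IH | apply term] |].
    to_real_ops; unfold Rdiv; ring.
Qed.

(** * Convergence of the partial sums and the value at [alpha = 1] *)

Lemma ex_RInt_atan_quotient (alpha a b : R) :
  ex_RInt (fun x => atan (alpha * x) / (1 + x ^ 2)) a b.
Proof.
  apply @ex_RInt_continuous; intros x _.
  assert (Hp := one_plus_sqr_pos x).
  apply (@ex_derive_continuous _ R_NormedModule).
  auto_derive; simpl in Hp; lra.
Qed.

(** On [0, 1] the Taylor error at [alpha * x] is at most [1 / (2 * N + 3)], weakened here to
    [1 / (N + 1)]; dividing by [1 + x ^ 2 >= 1] preserves the bound. *)
Lemma partial_sum_error (alpha : R) (N : nat) : Rabs alpha <= 1 ->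
  Rabs (sum_n (fun n => (ln 2 - skew_harmonic n) *
                        (alpha ^ (2 * n + 1) / INR (2 * n + 1))) N
        - 2 * RInt (fun x => atan (alpha * x) / (1 + x ^ 2)) 0 1)
  <= 2 / INR (S N).
Proof.
  intros Ha.
  set (S_N := sum_n _ N); set (J := RInt _ 0 1).
  assert (HI : is_RInt (fun x => minus (atan_poly N (alpha * x) / (1 + x ^ 2))
                                       (atan (alpha * x) / (1 + x ^ 2))) 0 1
                 (minus (S_N / 2) J)).
  { apply @is_RInt_minus; [apply atan_poly_is_RInt |].
    apply (@RInt_correct R_CompleteNormedModule), ex_RInt_atan_quotient. }
  assert (Hb := is_RInt_unique _ _ _ _ HI).
  assert (HM : Rabs (S_N / 2 - J) <= (1 - 0) * / INR (S N)).
  { change (S_N / 2 - J) with (minus (S_N / 2) J); rewrite <- Hb.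
    apply abs_RInt_le_const; [lra | eexists; exact HI |].
    intros x Hx.
    assert (Hp := one_plus_sqr_pos x).
    assert (Hz := pow2_ge_0 x).
    assert (HS : 0 < INR (S N)) by (apply lt_0_INR; lia).
    (* The hypothesis on [alpha] enters here: it makes the odd power in the Taylor error at most
       1. *)
    assert (Hay : Rabs (alpha * x) <= 1).
    { rewrite Rabs_mult, (Rabs_pos_eq x) by lra.
      generalize (Rabs_pos alpha); nra. }
    assert (Hnum : Rabs (atan (alpha * x) - atan_poly N (alpha * x)) <= / INR (S N)).
    { eapply Rle_trans; [apply atan_poly_error |].
      unfold Rdiv; rewrite Rabs_mult, <- RPow_abs.
      rewrite (Rabs_pos_eq (/ _)) by apply Rlt_le, Rinv_0_lt_compat, INR_odd_pos.
      rewrite <- (Rmult_1_l (/ INR (S N))).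
      apply Rmult_le_compat.
      - apply pow_le, Rabs_pos.
      - apply Rlt_le, Rinv_0_lt_compat, INR_odd_pos.
      - rewrite <- (pow1 (2 * S N + 1)); apply pow_incr; split;
          [apply Rabs_pos | exact Hay].
      - apply Rinv_le_contravar; [exact HS | apply le_INR; lia]. }
    replace (minus _ _) with
      (- ((atan (alpha * x) - atan_poly N (alpha * x)) / (1 + x ^ 2)))
      by (to_real_ops; unfold Rdiv; ring).
    unfold Rdiv; rewrite Rabs_Ropp, Rabs_mult, (Rabs_pos_eq (/ (1 + x ^ 2)))
      by (apply Rlt_le, Rinv_0_lt_compat, Hp).
    apply Rle_div_l; [lra |].
    eapply Rle_trans; [exact Hnum |].
    assert (Hi := Rinv_0_lt_compat _ HS); nra. }
  replace (S_N - 2 * J) with (2 * (S_N / 2 - J)) by field.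
  rewrite Rabs_mult, (Rabs_pos_eq 2) by lra.
  unfold Rdiv; lra.
Qed.

Lemma is_lim_seq_of_error_bound (u v : nat -> R) (l : R) :
  (forall n, Rabs (u n - l) <= v n) -> is_lim_seq v 0 -> is_lim_seq u l.
Proof.
  intros Hu Hv.
  apply (is_lim_seq_le_le (fun n => l - v n) u (fun n => l + v n)).
  - intros n; apply Rabs_le_between'; apply Hu.
  - replace l with (l - 0) at 1 by ring.
    apply is_lim_seq_minus'; [apply is_lim_seq_const | exact Hv].
  - replace l with (l + 0) at 1 by ring.
    apply is_lim_seq_plus'; [apply is_lim_seq_const | exact Hv].
Qed.

Lemma is_lim_seq_div_S (c : R) : is_lim_seq (fun n => c / INR (S n)) 0.
Proof.
  replace 0 with (c * 0) by ring.
  apply (is_lim_seq_scal_l _ c 0).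
  (* The shifted sequence takes the default value [/ 0] at [n = 0], which does not affect the
     limit. *)
  apply (is_lim_seq_incr_1 (fun n => / INR n)).
  apply (is_lim_seq_inv INR p_infty); [apply is_lim_seq_INR | discriminate].
Qed.

(** The value is half of [(PI / 4) ^ 2]. The factor [1 *] is kept so that the integral matches the
    general one at [alpha = 1]. *)
Lemma RInt_atan_quotient_1 :
  RInt (fun x => atan (1 * x) / (1 + x ^ 2)) 0 1 = PI ^ 2 / 32.
Proof.
  apply is_RInt_unique.
  evar_last.
  { apply (is_RInt_derive (fun x => atan x ^ 2 / 2)).
    - intros x _; assert (Hp := one_plus_sqr_pos x).
      auto_derive; [easy |].
      rewrite (Rmult_1_l x); unfold Rsqr; simpl in *; field; nra.
    - intros x _; assert (Hp := one_plus_sqr_pos x).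
      apply (@ex_derive_continuous _ R_NormedModule).
      auto_derive; simpl in Hp; lra. }
  rewrite atan_1, atan_0; to_real_ops; field.
Qed.

Theorem proposition2 :
  (forall alpha : R, Rabs alpha <= 1 ->
     is_series
       (fun n : nat =>
          (ln 2 - skew_harmonic n) * (alpha ^ (2 * n + 1) / INR (2 * n + 1)))
       (2 * RInt (fun x : R => atan (alpha * x) / (1 + x ^ 2)) 0 1))
  /\
  is_series
    (fun n : nat => (ln 2 - skew_harmonic n) * (1 / INR (2 * n + 1)))
    (PI ^ 2 / 16).
Proof.
  assert (general : forall alpha : R, Rabs alpha <= 1 ->
     is_series
       (fun n : nat =>
          (ln 2 - skew_harmonic n) * (alpha ^ (2 * n + 1) / INR (2 * n + 1)))
       (2 * RInt (fun x : R => atan (alpha * x) / (1 + x ^ 2)) 0 1)).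
  { intros alpha Ha.
    (* [is_series] unfolds to convergence of the partial sums [sum_n], so a limit of sequences
       proves it. *)
    apply (is_lim_seq_of_error_bound _ (fun n => 2 / INR (S n))).
    - intros N; apply partial_sum_error, Ha.
    - apply is_lim_seq_div_S. }
  split; [exact general |].
  replace (PI ^ 2 / 16) with (2 * (PI ^ 2 / 32)) by field.
  rewrite <- RInt_atan_quotient_1.
  eapply is_series_ext; [| apply general; rewrite Rabs_R1; lra].
  intros n; cbv beta; rewrite pow1; reflexivity.
Qed.
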